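(* Let $H_X\in\mathbb{F}_2^{m_X\times n}$, $H_Z\in\mathbb{F}_2^{m_Z\times n}$ with $H_XH_Z^\top=0$ define an $\llbracket n,k,d_{\min}\rrbracket$ CSS code with rate $R=k/n$ and minimum distance $d_{\min}$. For each $Z$-syndrome $s_Z$ let $\mathcal{D}_X(s_Z)$ be the set of degeneracy classes and let $\mathcal{D}_\delta(s_Z)\subseteq\mathcal{D}_X(s_Z)$ be the subset of classes that are admissible under a directional model. Set $$f(\delta_{\max},R):=\sup_{s_Z}\frac{|\mathcal{D}_\delta(s_Z)|}{|\mathcal{D}_X(s_Z)|}.$$ Then for every syndrome $s_Z$, $$|\mathcal{D}_\delta(s_Z)|\le 2^{k}f(\delta_{\max},R)\le 2^{\,n-2d_{\min}+2}f(\delta_{\max},R).$$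
   Context: CSS code: $S_X$, $S_Z$ are the row spaces of $H_X,H_Z$; $C_X=\ker H_X$, $C_Z=\ker H_Z$; since $H_XH_Z^\top=0$, $S_X\subseteq C_Z$ and $S_Z\subseteq C_X$. The number of logical qubits is $k=n-\operatorname{rank}(H_X)-\operatorname{rank}(H_Z)$. The notation $\llbracket n,k,d_{\min}\rrbracket$ is the standard one for a quantum code on $n$ qubits with $k$ logical qubits and minimum (Hamming) distance $d_{\min}$, i.e. the minimum Hamming weight of a nontrivial logical operator; nontrivial logical operators of the CSS code are given by the vectors in $(C_Z\setminus S_X)\cup(C_X\setminus S_Z)$ when this set is nonempty (if it is empty, $d_{\min}$ is the distance in whatever standard convention is used for codes with $k=0$). Syndromes and degeneracy classes: a $Z$-syndrome is a vector $s_Z$ in the image of $H_Z$. If $e_0$ is any solution of $H_Ze=s_Z$, then $\mathcal{D}_X(s_Z)=(e_0+C_Z)/S_X$ is the set of cosets of $S_X$ contained in the solution set $e_0+C_Z$ of $H_Ze=s_Z$. Admissibility: the directional model filters classes by some admissibility rule, which is arbitrary; for each $s_Z$, $\mathcal{D}_\delta(s_Z)$ is the resulting subset of $\mathcal{D}_X(s_Z)$. The symbol $\delta_{\max}\ge0$ is any scalar summarizing the maximum directional bias (for instance, the largest entry of a nonnegative matrix of weights on the edges of the Tanner graph of $H_X$), and $f(\delta_{\max},R)$ is notation for the displayed supremum, taken over all $Z$-syndromes. *)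

(* Defs.v *)
From mathcomp Require Import all_boot all_order all_algebra.
From mathcomp Require Import classical_sets reals.

Set Implicit Arguments.
Unset Strict Implicit.
Unset Printing Implicit Defensive.

Import Order.TTheory GRing.Theory Num.Theory.
Local Open Scope ring_scope.

Definition hamming_weight (n : nat) (v : 'cV['F_2]_n) : nat :=
  #|[set i | v i ord0 != 0]|%SET.

(* Elements of F_2^n are column vectors, so the row space of H consists of
   the v whose transpose lies in the row space of H. *)
Definition row_space (m n : nat) (H : 'M['F_2]_(m, n)) :
    {set 'cV['F_2]_n} := [set v | (v^T <= H)%MS]%SET.

Definition null_space (m n : nat) (H : 'M['F_2]_(m, n)) :
    {set 'cV['F_2]_n} := [set v | H *m v == 0]%SET.

Definition nontrivial_logicals (mX mZ n : nat)
    (HX : 'M['F_2]_(mX, n)) (HZ : 'M['F_2]_(mZ, n)) : {set 'cV['F_2]_n} :=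
  (null_space HZ :\: row_space HX) :|: (null_space HX :\: row_space HZ).

Definition is_min_weight (n : nat) (A : {set 'cV['F_2]_n}) (d : nat) : Prop :=
  (exists2 v, v \in A & hamming_weight v = d) /\
  (forall v, v \in A -> (d <= hamming_weight v)%N).

(* Without nontrivial logical operators (k = 0), the distance is by the usual
   convention for [[n, 0, d]] stabilizer codes the least weight of a nontrivial
   stabilizer; a stabilizer with X-part x and Z-part z weighs at least as much
   as x and as z, so the pure ones suffice. *)
Definition is_css_distance (mX mZ n : nat)
    (HX : 'M['F_2]_(mX, n)) (HZ : 'M['F_2]_(mZ, n)) (d : nat) : Prop :=
  if nontrivial_logicals HX HZ != finset.set0
  then is_min_weight (nontrivial_logicals HX HZ) d
  else is_min_weight ((row_space HX :|: row_space HZ) :\ 0) d.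

(* HX *m HZ^T = 0 gives \rank HX + \rank HZ <= n, so the subtractions are not
   truncated. The distance condition excludes n = 0. *)
Definition is_css_code (mX mZ n : nat)
    (HX : 'M['F_2]_(mX, n)) (HZ : 'M['F_2]_(mZ, n)) (k d : nat) : Prop :=
  [/\ HX *m HZ^T = 0,
      k = (n - \rank HX - \rank HZ)%N
    & is_css_distance HX HZ d].

Definition Zsyndromes (mZ n : nat) (HZ : 'M['F_2]_(mZ, n)) :
    {set 'cV['F_2]_mZ} := [set HZ *m e | e : 'cV['F_2]_n]%SET.

(* The cosets e + S_X, for e in the solution set e_0 + C_Z of HZ e = s. *)
Definition degeneracy_classes (mX mZ n : nat)
    (HX : 'M['F_2]_(mX, n)) (HZ : 'M['F_2]_(mZ, n)) (s : 'cV['F_2]_mZ) :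
    {set {set 'cV['F_2]_n}} :=
  [set [set e + x | x in row_space HX] | e : 'cV['F_2]_n & HZ *m e == s]%SET.

Definition sup_admissible_fraction (R : realType) (mX mZ n : nat)
    (HX : 'M['F_2]_(mX, n)) (HZ : 'M['F_2]_(mZ, n))
    (D : 'cV['F_2]_mZ -> {set {set 'cV['F_2]_n}}) : R :=
  sup [set #|D s|%:R / #|degeneracy_classes HX HZ s|%:R
      | s in [set` Zsyndromes HZ]]%classic.
Arguments sup_admissible_fraction R {mX mZ n} HX HZ D.

(* Main.v *)
(* Each fibre D_X(s) embeds in a translate of C_Z / S_X, so it has at most 2^k
   classes and the first inequality is |D_delta| <= |D_X| f. The second is the
   quantum Singleton bound k <= n - 2d + 2: cleaning a set A of d - 1 qubits
   moves all k independent Z-logicals off A, and a further d - 1 qubits carry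
   none of them, so k is at most the number of remaining qubits. For k = 0 it is
   the sum of the classical Singleton bounds for S_X and S_Z. *)
Require Import Defs.
From mathcomp Require Import all_boot all_order all_algebra.
From mathcomp Require Import classical_sets reals.
From mathcomp Require Import mxabelem zify.

Set Implicit Arguments.
Unset Strict Implicit.
Unset Printing Implicit Defensive.

Import Order.TTheory GRing.Theory Num.Theory.
Local Open Scope ring_scope.

(** * Restriction to coordinates, and rank identities *)

(** Right multiplication by it restricts a row vector to the coordinates in [A]; the row space of
    its transpose is the space of vectors supported on [A]. *)
Definition coord_proj (F : fieldType) (n : nat) (A : {set 'I_n}) :
    'M[F]_(n, #|A|) := \matrix_(i, j) (i == enum_val j)%:R.

Lemma mul_coord_proj_eq0 (F : fieldType) (n : nat) (A : {set 'I_n})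
    (v : 'rV[F]_n) :
  v *m coord_proj F A = 0 -> {in A, forall i, v 0 i = 0}.
Proof.
move=> /rowP vA0 i iA; have := vA0 (enum_rank_in iA i).
rewrite !mxE (bigD1 i) //= mxE enum_rankK_in // eqxx mulr1 big1 ?addr0 //.
by move=> j /negPf ji; rewrite mxE enum_rankK_in // ji mulr0.
Qed.

Lemma sub_coord_proj_tr (F : fieldType) (n : nat) (A : {set 'I_n})
    (v : 'rV[F]_n) :
  (v <= (coord_proj F A)^T)%MS -> forall i, i \notin A -> v 0 i = 0.
Proof.
case/submxP=> D -> i iA; rewrite mxE big1 // => j _.
rewrite !mxE; case: eqP => [ij|]; last by rewrite mulr0.
by rewrite ij enum_valP in iA.
Qed.

(** Rank-nullity for [V *m S] and for its transpose, which have equal rank. *)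
Lemma mxrank_mulmx_dual (F : fieldType) (m n p : nat)
    (V : 'M[F]_(m, n)) (S : 'M[F]_(n, p)) :
  (\rank V + \rank (S^T :&: kermx V^T) = \rank (V :&: kermx S) + \rank S)%N.
Proof.
have := mxrank_mul_ker V S; have := mxrank_mul_ker S^T V^T.
by rewrite -trmx_mul !mxrank_tr => <- <-; rewrite -addnA addnCA.
Qed.

(** Restricting [V] to [C] has rank at most [#|C|], and its kernel lies in [U]. *)
Lemma relative_singleton (F : fieldType) (m p n : nat) (V : 'M[F]_(m, n))
    (U : 'M[F]_(p, n)) (C : {set 'I_n}) :
  (forall v : 'rV_n, (v <= V)%MS -> {in C, forall i, v 0 i = 0} ->
     (v <= U)%MS) ->
  (\rank V <= \rank U + #|C|)%N.
Proof.
move=> VU; rewrite -(mxrank_mul_ker V (coord_proj F C)) addnC leq_add //.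
  apply: mxrankS; apply/rV_subP => v; rewrite sub_capmx.
  by case/andP=> vV /sub_kermxP/mul_coord_proj_eq0; apply: VU.
exact: rank_leq_col.
Qed.

(** * Hamming weight and the classical Singleton bound *)

Lemma card_ord_range (n a b : nat) :
  (#|[set i : 'I_n | a <= i < b]| <= b - a)%N.
Proof.
rewrite cardE -(size_map val) -(size_iota a (b - a)).
apply: uniq_leq_size; first by rewrite (map_inj_uniq val_inj) enum_uniq.
move=> _ /mapP[i + ->]; rewrite mem_enum inE mem_iota /=; lia.
Qed.

Lemma hamming_weight_leq (n : nat) (v : 'rV['F_2]_n) (B : {set 'I_n}) :
  (forall i, i \notin B -> v 0 i = 0) -> (hamming_weight v^T <= #|B|)%N.
Proof.
move=> vB; apply/subset_leq_card/fintype.subsetP => i; rewrite inE mxE.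
by apply: contraR => /vB ->.
Qed.

Lemma hamming_weight_leq_dim (n : nat) (v : 'cV['F_2]_n) :
  (hamming_weight v <= n)%N.
Proof. by rewrite -[leqRHS]card_ord max_card. Qed.

(** A vector of [V] vanishing on all but [d - 1] coordinates is zero. For [V = 0] the weight
    condition is vacuous, and [d <= n] alone bounds [d]. *)
Lemma classical_singleton (m n d : nat) (V : 'M['F_2]_(m, n)) :
  (d <= n)%N ->
  (forall v : 'rV_n, (v <= V)%MS -> v != 0 -> (d <= hamming_weight v^T)%N) ->
  (\rank V + d <= n + 1)%N.
Proof.
case: d => [|d] dn dV; first by have := rank_leq_col V; lia.
pose C := [set i : 'I_n | (d <= i < n)%N].
suff: (\rank V <= \rank (0%R : 'M['F_2]_n) + #|C|)%N.
  by rewrite mxrank0; have := card_ord_range n d n; rewrite -/C; lia.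
apply: relative_singleton => v vV vC; rewrite submx0.
apply: contraLR (leqnn d) => v0; rewrite -ltnNge.
apply: leq_trans (dV v vV v0) _.
pose B := [set i : 'I_n | (0 <= i < d)%N].
apply: (@leq_trans #|B|); first apply: hamming_weight_leq.
  by move=> i iB; apply: vC; move: iB (ltn_ord i); rewrite !inE; lia.
by have := card_ord_range n 0 d; rewrite subn0.
Qed.

(** * CSS orthogonality and cleaning *)

Lemma css_sub_kerZ (F : fieldType) (mX mZ n : nat) (HX : 'M[F]_(mX, n))
    (HZ : 'M[F]_(mZ, n)) :
  HX *m HZ^T = 0 -> (HX <= kermx HZ^T)%MS.
Proof. by move=> HXZ; apply/sub_kermxP. Qed.

Lemma css_sub_kerX (F : fieldType) (mX mZ n : nat) (HX : 'M[F]_(mX, n))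
    (HZ : 'M[F]_(mZ, n)) :
  HX *m HZ^T = 0 -> (HZ <= kermx HX^T)%MS.
Proof.
by move=> HXZ; apply/sub_kermxP; rewrite -[LHS]trmxK trmx_mul trmxK HXZ trmx0.
Qed.

Lemma css_rank_leq (F : fieldType) (mX mZ n : nat) (HX : 'M[F]_(mX, n))
    (HZ : 'M[F]_(mZ, n)) :
  HX *m HZ^T = 0 -> (\rank HX + \rank HZ <= n)%N.
Proof.
move=> HXZ; have := mxrankS (css_sub_kerZ HXZ); rewrite mxrank_ker mxrank_tr.
by have := rank_leq_col HZ; lia.
Qed.

Lemma null_space_tr (m n : nat) (H : 'M['F_2]_(m, n)) (v : 'rV_n) :
  (v^T \in null_space H) = (v <= kermx H^T)%MS.
Proof.
by rewrite inE sub_kermx -(inj_eq trmx_inj) trmx_mul trmxK trmx0.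
Qed.

Lemma row_space_tr (m n : nat) (H : 'M['F_2]_(m, n)) (v : 'rV_n) :
  (v^T \in row_space H) = (v <= H)%MS.
Proof. by rewrite inE trmxK. Qed.

(* The cleaning lemma: a correctable set A carries no X-logicals, hence every
   Z-logical class has a representative off A, so k is the rank of the
   Z-logicals off A modulo the Z-stabilizers off A. If the complement of A and C
   carries no Z-logicals either, this rank is at most #|C|. *)
Lemma css_cleaning (F : fieldType) (mX mZ n : nat) (HX : 'M[F]_(mX, n))
    (HZ : 'M[F]_(mZ, n)) (A C : {set 'I_n}) :
  (forall v : 'rV_n, (v <= kermx HZ^T)%MS ->
     (forall i, i \notin A -> v 0 i = 0) -> (v <= HX)%MS) ->
  (forall v : 'rV_n, (v <= kermx HX^T)%MS ->
     {in A, forall i, v 0 i = 0} -> {in C, forall i, v 0 i = 0} ->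
     (v <= HZ)%MS) ->
  (n - \rank HX - \rank HZ <= #|C|)%N.
Proof.
move=> noX noZ; pose S := coord_proj F A.
(* Vectors of C_Z supported on [A] are X-stabilizers, hence orthogonal to all of C_X. *)
have clean : (S^T :&: kermx HZ^T <= S^T :&: kermx (kermx HX^T)^T)%MS.
  apply/rV_subP => v; rewrite !sub_capmx => /andP[vS vZ]; rewrite vS /=.
  have /submx_trans: (v <= HX)%MS by apply: noX => //; apply: sub_coord_proj_tr.
  apply; apply/sub_kermxP.
  by rewrite -[LHS]trmxK trmx_mul trmxK mulmx_ker trmx0.
have off : (\rank (kermx HX^T :&: kermx S) <= \rank (HZ :&: kermx S) + #|C|)%N.
  apply: relative_singleton => v; rewrite !sub_capmx => /andP[vX vS] vC.
  rewrite vS andbT; apply: noZ => //.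
  exact/mul_coord_proj_eq0/sub_kermxP.
(* Subtracting the two dual rank identities, [clean] shows that passing to vectors vanishing on [A]
   does not decrease dim C_X - dim S_Z. *)
have := mxrank_mulmx_dual (kermx HX^T) S; have := mxrank_mulmx_dual HZ S.
by have := mxrankS clean; rewrite mxrank_ker mxrank_tr; lia.
Qed.

(** * The quantum Singleton bound *)

Lemma css_singleton_logicals (mX mZ n d : nat) (HX : 'M['F_2]_(mX, n))
    (HZ : 'M['F_2]_(mZ, n)) :
  (forall v, v \in nontrivial_logicals HX HZ -> (d < hamming_weight v)%N) ->
  (n - \rank HX - \rank HZ <= n - d.*2)%N.
Proof.
move=> dmin.
have lightX (v : 'rV_n) : (v <= kermx HZ^T)%MS -> (hamming_weight v^T <= d)%N ->
    (v <= HX)%MS.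
  move=> vZ; apply: contraLR => vX; rewrite -ltnNge dmin //.
  by rewrite inE finset.in_setD null_space_tr row_space_tr vZ vX.
have lightZ (v : 'rV_n) : (v <= kermx HX^T)%MS -> (hamming_weight v^T <= d)%N ->
    (v <= HZ)%MS.
  move=> vX; apply: contraLR => vZ; rewrite -ltnNge dmin //.
  by rewrite inE !finset.in_setD !null_space_tr !row_space_tr vZ vX orbT.
(* Here [d] is the distance minus one: [A] and [B] are blocks of at most [d] qubits, too small to
   support a nontrivial logical, and [C] is the rest. *)
pose A := [set i : 'I_n | (0 <= i < d)%N].
pose B := [set i : 'I_n | (d <= i < d.*2)%N].
pose C := [set i : 'I_n | (d.*2 <= i < n)%N].
have cA : (#|A| <= d)%N by have := card_ord_range n 0 d; rewrite subn0.
have cB : (#|B| <= d)%N by have := card_ord_range n d d.*2; rewrite -/B; lia.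
have cC : (#|C| <= n - d.*2)%N by exact: card_ord_range.
apply: leq_trans cC; apply: (@css_cleaning _ _ _ _ _ _ A) => v.
- move=> vZ vA; apply: lightX => //; apply: leq_trans cA.
  exact: hamming_weight_leq.
- move=> vX vA vC; apply: lightZ => //; apply: leq_trans cB.
  apply: hamming_weight_leq => i iB.
  have [/vA //|iA] := boolP (i \in A).
  by apply: vC; move: iA iB (ltn_ord i); rewrite !inE; lia.
Qed.

(** There are no nontrivial logicals exactly when both inclusions of S_X in C_Z and S_Z in C_X are
    equalities, which is decided by dimensions. *)
Lemma nontrivial_logicals_neq0 (mX mZ n : nat) (HX : 'M['F_2]_(mX, n))
    (HZ : 'M['F_2]_(mZ, n)) :
  HX *m HZ^T = 0 ->
  (nontrivial_logicals HX HZ != finset.set0) = (\rank HX + \rank HZ < n)%N.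
Proof.
move=> HXZ; apply/idP/idP.
- case/set0Pn => v; rewrite -[v]trmxK inE !finset.in_setD.
  rewrite !null_space_tr !row_space_tr.
  move=> nontriv; rewrite ltn_neqAle css_rank_leq // andbT.
  apply: contraL nontriv => /eqP rk.
  have rX : (kermx HZ^T <= HX)%MS.
    by rewrite -mxrank_leqif_sup ?css_sub_kerZ // mxrank_ker mxrank_tr; lia.
  have rZ : (kermx HX^T <= HZ)%MS.
    by rewrite -mxrank_leqif_sup ?css_sub_kerX // mxrank_ker mxrank_tr; lia.
  rewrite negb_or !negb_and !negbK.
  rewrite ![_ || ~~ _]orbC -!implybE; apply/andP.
  by split; apply/implyP => /submx_trans; apply.
- apply: contraTneq => no_log; rewrite -leqNgt.
  have: (kermx HZ^T <= HX)%MS.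
    apply/rV_subP => v vZ; apply: contraT => vX.
    have: v^T \in nontrivial_logicals HX HZ.
      by rewrite inE finset.in_setD null_space_tr row_space_tr vZ vX.
    by rewrite no_log inE.
  by move/mxrankS; rewrite mxrank_ker mxrank_tr; lia.
Qed.

Lemma css_singleton (mX mZ n d : nat) (HX : 'M['F_2]_(mX, n))
    (HZ : 'M['F_2]_(mZ, n)) :
  HX *m HZ^T = 0 -> is_css_distance HX HZ d ->
  (n - \rank HX - \rank HZ + d.*2 <= n + 2)%N.
Proof.
move=> HXZ; rewrite /is_css_distance nontrivial_logicals_neq0 //.
case: ltnP => [k_gt0 | k0] [[v _ vd] dmin].
- case: d vd dmin => [|d] _ dmin; first lia.
  (* As k > 0, the bound k <= [n - d.*2] forces [d.*2 < n], so the subtraction is not truncated. *)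
  by have := css_singleton_logicals dmin; lia.
- have dn : (d <= n)%N by rewrite -vd hamming_weight_leq_dim.
  have rX : (\rank HX + d <= n + 1)%N.
    apply: classical_singleton => // w wX w0; apply: dmin.
    by rewrite !inE trmxK wX -trmx0 (inj_eq trmx_inj) w0.
  have rZ : (\rank HZ + d <= n + 1)%N.
    apply: classical_singleton => // w wZ w0; apply: dmin.
    by rewrite !inE trmxK wZ -trmx0 (inj_eq trmx_inj) w0 orbT.
  by have := css_rank_leq HXZ; lia.
Qed.

(** * Counting degeneracy classes *)

Lemma card_degeneracy_classes_leq (mX mZ n : nat) (HX : 'M['F_2]_(mX, n))
    (HZ : 'M['F_2]_(mZ, n)) (s : 'cV['F_2]_mZ) :
  HX *m HZ^T = 0 -> s \in Zsyndromes HZ ->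
  (#|degeneracy_classes HX HZ s| <= 2 ^ (n - \rank HX - \rank HZ))%N.
Proof.
move=> HXZ /imsetP[e0 _ ->].
(* [cokermx HX] annihilates exactly S_X, so the row space of [K] is a copy of C_Z / S_X. *)
pose K := kermx HZ^T *m cokermx HX.
have rK : \rank K = (n - \rank HX - \rank HZ)%N.
  have := mxrank_mul_ker (kermx HZ^T) (cokermx HX); rewrite -/K.
  have -> : \rank (kermx HZ^T :&: kermx (cokermx HX)) = \rank HX.
    apply/eqmx_rank/andP; split; apply/rV_subP => v; rewrite !sub_capmx.
      by case/andP=> _; rewrite sub_kermx submxE.
    move=> vX; rewrite (submx_trans vX (css_sub_kerZ HXZ)) sub_kermx.
    by rewrite -submxE.
  by rewrite mxrank_ker mxrank_tr; lia.
(* [g w] collects the [v] for which [v - e0] has image [w] modulo S_X; the class of [e] is [g] at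
   the image of [e - e0]. *)
pose g (w : 'rV['F_2]_n) :=
  [set v : 'cV['F_2]_n | (v - e0)^T *m cokermx HX == w]%SET.
have sub : degeneracy_classes HX HZ (HZ *m e0) \subset g @: rowg K.
  apply/fintype.subsetP => _ /imsetP[e + ->]; rewrite inE => /eqP eq_e.
  apply/imsetP; exists ((e - e0)^T *m cokermx HX).
    rewrite mem_rowg submxMr // sub_kermx -trmx_mul mulmxBr eq_e subrr trmx0.
    by rewrite eqxx.
  apply/setP => v; rewrite inE -subr_eq0 -mulmxBl -linearB /= opprB addrA subrK.
  rewrite -submxE; apply/imsetP/idP => [[x + ->]|ve].
    by rewrite inE [e + x]addrC addrK.
  by exists (v - e); rewrite ?inE // addrC subrK.
apply: leq_trans (subset_leq_card sub) _.
by rewrite (leq_trans (leq_imset_card _ _)) // card_rowg card_Fp // rK.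
Qed.

(** * The supremum and the two inequalities *)

Lemma le_sup_admissible_fraction (R : realType) (mX mZ n : nat)
    (HX : 'M['F_2]_(mX, n)) (HZ : 'M['F_2]_(mZ, n))
    (D : 'cV['F_2]_mZ -> {set {set 'cV['F_2]_n}}) (s : 'cV['F_2]_mZ) :
  (forall t, t \in Zsyndromes HZ -> D t \subset degeneracy_classes HX HZ t) ->
  s \in Zsyndromes HZ ->
  #|D s|%:R / #|degeneracy_classes HX HZ s|%:R
    <= sup_admissible_fraction R HX HZ D.
Proof.
move=> subD sZ; apply: ub_le_sup; last by exists s.
(* [sup] is a genuine least upper bound only for bounded sets; the fractions are at most 1, a zero
   denominator giving 0. *)
exists 1 => _ [t tZ <-].
have [->|nz] := eqVneq #|degeneracy_classes HX HZ t| 0%N.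
  by rewrite invr0 mulr0.
by rewrite ler_pdivrMr ?ltr0n ?lt0n // mul1r ler_nat subset_leq_card // subD.
Qed.

Theorem lemma2 (R : realType) (mX mZ n k dmin : nat)
    (HX : 'M['F_2]_(mX, n)) (HZ : 'M['F_2]_(mZ, n))
    (hcode : is_css_code HX HZ k dmin)
    (Ddelta : 'cV['F_2]_mZ -> {set {set 'cV['F_2]_n}})
    (hDdelta : forall s, s \in Zsyndromes HZ ->
       Ddelta s \subset degeneracy_classes HX HZ s)
    (deltamax rate : R) (hdeltamax : 0 <= deltamax)
    (hrate : rate = k%:R / n%:R)
    (f : R -> R -> R)
    (hf : f deltamax rate = sup_admissible_fraction R HX HZ Ddelta)
    (s : 'cV['F_2]_mZ) (hs : s \in Zsyndromes HZ) :
  #|Ddelta s|%:R <= 2 ^+ k * f deltamax rate /\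
  2 ^+ k * f deltamax rate
    <= 2 ^ (n%:Z - 2 * dmin%:Z + 2) * f deltamax rate.
Proof.
case: hcode => HXZ kE hd; rewrite hf.
have := le_sup_admissible_fraction R hDdelta hs.
set F := sup_admissible_fraction _ _ _ _ => leF.
have F0 : 0 <= F by apply: le_trans leF; rewrite divr_ge0.
have le_k := card_degeneracy_classes_leq HXZ hs; rewrite -kE in le_k.
split.
- have [D0|nz] := eqVneq #|degeneracy_classes HX HZ s| 0%N.
    have := subset_leq_card (hDdelta s hs); rewrite D0 leqn0 => /eqP ->.
    by rewrite mulr_ge0 // exprn_ge0.
  move: leF; rewrite ler_pdivrMr ?ltr0n ?lt0n // mulrC => /le_trans; apply.
  by rewrite ler_wpM2r // -natrX ler_nat.
(* The right-hand exponent is an integer, so [2 ^+ k] is first read as an integer power. *)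
- rewrite ler_wpM2r // exprnP ler_weXz2l ?ler1n //.
  by have := css_singleton HXZ hd; rewrite -kE; lia.
Qed.
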